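(* For every integer $n\geq 2$ and every integer $m\geq 1$, $\chi_d^t(P_n\circ \overline{K_m})=n+1$.
   Context: All graphs are finite and simple. For a graph $G$ with no isolated vertex, a total dominator coloring (TD-coloring) of $G$ is a proper coloring of the vertices of $G$ in which each vertex of $G$ is adjacent to every vertex of some (nonempty) color class. The total dominator chromatic number $\chi_d^t(G)$ is the minimum number of color classes in a TD-coloring of $G$. For graphs $G$ and $H$, the corona $G\circ H$ is the graph arising from the disjoint union of $G$ with $|V(G)|$ copies of $H$ by adding edges between the $i$th vertex of $G$ and all vertices of the $i$th copy of $H$. $P_n$ denotes the path on $n$ vertices, and $\overline{K_m}$ is the complement of the complete graph $K_m$, i.e. the edgeless graph on $m$ vertices. *)

(* Defs.v *)
From HB Require Import structures.
From mathcomp Require Import all_boot.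

Set Implicit Arguments.
Unset Strict Implicit.
Unset Printing Implicit Defensive.

Record sgraph := SGraph {
  vertex :> finType;
  adj : rel vertex;
  adj_sym : symmetric adj;
  adj_irrefl : irreflexive adj }.

Section TotalDominatorColoring.
Variable G : sgraph.
Implicit Types (x y : G) (A : {set G}) (P : {set {set G}}).

Definition neighbors x : {set G} := [set y | adj x y].

Definition no_isolated_vertex : bool := [forall x : G, exists y : G, adj x y].

Definition independent A : bool := [forall x in A, forall y in A, ~~ adj x y].

(* A coloring is identified with the set of its color classes, a partition of
   the vertex set; [partition] excludes the empty class. *)
Definition proper_coloring P : bool :=
  partition P [set: G] && [forall A in P, independent A].

Definition td_coloring P : bool :=
  proper_coloring P && [forall x, exists A in P, A \subset neighbors x].

Definition singletons : {set {set G}} := [set [set x] | x : G].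

(* The default [singletons] of [arg min] is a TD-coloring exactly when [G] has
   no isolated vertex, see [td_coloring_singletons]; otherwise [G] has no
   TD-coloring and the value below is meaningless. *)
Definition td_chromatic_number : nat :=
  #|[arg min_(P < singletons | td_coloring P) #|P|]|.

Lemma td_coloring_no_isolated P : td_coloring P -> no_isolated_vertex.
Proof.
case/andP=> /andP[/and3P[_ _ P0] _] /forallP Ptd.
apply/forallP=> x; have /existsP[A /andP[PA /subsetP sA]] := Ptd x.
have [A0|[y Ay]] := set_0Vmem A; first by rewrite -A0 PA in P0.
by apply/existsP; exists y; have := sA y Ay; rewrite inE.
Qed.

Lemma td_coloring_singletons : td_coloring singletons = no_isolated_vertex.
Proof.
apply/idP/idP=> [|/forallP Giso]; first exact: td_coloring_no_isolated.
apply/andP; split; last first.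
  apply/forallP=> x; have /existsP[y xy] := Giso x.
  by apply/existsP; exists [set y]; rewrite imset_f // sub1set inE.
apply/andP; split.
  apply/and3P; split.
  - apply/eqP/setP=> x; rewrite inE; apply/bigcupP; exists [set x].
      exact: imset_f.
    by rewrite inE.
  - apply/trivIsetP=> _ _ /imsetP[x _ ->] /imsetP[y _ ->] xy.
    by rewrite disjoints1 inE; apply: contraNneq xy => ->.
  - by apply/imsetP=> -[x _ /setP/(_ x)]; rewrite !inE eqxx.
apply/forall_inP=> _ /imsetP[x _ ->].
apply/forall_inP=> y /set1P->; apply/forall_inP=> z /set1P->.
by rewrite adj_irrefl.
Qed.

Lemma td_chromatic_numberP : no_isolated_vertex ->
  (exists2 P, td_coloring P & #|P| = td_chromatic_number) /\
  (forall P, td_coloring P -> td_chromatic_number <= #|P|).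
Proof.
rewrite -td_coloring_singletons /td_chromatic_number => td1.
by case: arg_minnP => // P tdP minP; split=> //; exists P.
Qed.

End TotalDominatorColoring.

Section Corona.
Variables G H : sgraph.

(* [inl x] is the vertex [x] of [G], and [inr (x, h)] is the vertex [h] of the
   copy of [H] attached to [x]. *)
Definition corona_adj : rel (G + G * H) := fun u v =>
  match u, v with
  | inl x, inl y => adj x y
  | inl x, inr (y, _) => x == y
  | inr (x, _), inl y => x == y
  | inr (x, h), inr (y, k) => (x == y) && adj h k
  end.

Lemma corona_sym : symmetric corona_adj.
Proof.
by move=> [x|[x h]] [y|[y k]] //=; rewrite 1?[x == y]eq_sym // adj_sym.
Qed.

Lemma corona_irrefl : irreflexive corona_adj.
Proof. by case=> [x|[x h]] /=; rewrite adj_irrefl ?andbF. Qed.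

Definition corona : sgraph := SGraph corona_sym corona_irrefl.

End Corona.

Section Complement.
Variable G : sgraph.

Definition complement_adj : rel G := fun x y => (x != y) && ~~ adj x y.

Lemma complement_sym : symmetric complement_adj.
Proof. by move=> x y; rewrite /complement_adj eq_sym adj_sym. Qed.

Lemma complement_irrefl : irreflexive complement_adj.
Proof. by move=> x; rewrite /complement_adj eqxx. Qed.

Definition complement : sgraph := SGraph complement_sym complement_irrefl.

End Complement.

Section CompleteAndPath.
Variable n : nat.

Definition complete_adj : rel 'I_n := fun i j => i != j.

Lemma complete_sym : symmetric complete_adj.
Proof. by move=> i j; rewrite /complete_adj eq_sym. Qed.

Lemma complete_irrefl : irreflexive complete_adj.
Proof. by move=> i; rewrite /complete_adj eqxx. Qed.

Definition complete_graph : sgraph := SGraph complete_sym complete_irrefl.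

Definition path_adj : rel 'I_n := fun i j => (i.+1 == j :> nat) || (j.+1 == i :> nat).

Lemma path_sym : symmetric path_adj.
Proof. by move=> i j; rewrite /path_adj orbC. Qed.

Lemma path_irrefl : irreflexive path_adj.
Proof. by move=> i; rewrite /path_adj orbb; apply/negbTE; rewrite gtn_eqF. Qed.

Definition path_graph : sgraph := SGraph path_sym path_irrefl.

End CompleteAndPath.

Lemma corona_no_isolated (G H : sgraph) :
  0 < #|H| -> no_isolated_vertex (corona G H).
Proof.
case/card_gt0P=> h _; apply/forallP=> -[x|[x k]]; apply/existsP.
  by exists (inr (x, h)); exact: eqxx.
by exists (inl x); exact: eqxx.
Qed.

(* Main.v *)
Require Import Defs.
From mathcomp Require Import all_boot.

(** In a corona with an edgeless graph the vertices of the copies are pendant: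
    the only neighbor of such a vertex is the base vertex that carries it, and
    a color class inside a one-element neighborhood is that whole neighborhood.
    So a TD-coloring has each base vertex as a class of its own
    ([td_coloring_pendant]), and the pendant vertices need at least one further
    class. Conversely one further class is enough, since the pendant vertices
    form an independent set and a base vertex with a neighbor in the base graph
    dominates the singleton class of that neighbor. For a
    nonempty base graph without isolated vertices the value is therefore its
    order plus one ([td_chromatic_number_corona_edgeless]), and a path on at
    least two vertices is such a graph ([path_no_isolated]). *)

Lemma td_coloring_pendant (G : sgraph) (P : {set {set G}}) (u v : G) :
  neighbors v = [set u] -> td_coloring P -> [set u] \in P.
Proof.
move=> Nv /andP[/andP[/and3P[_ _ P0] _] /forallP/(_ v)/existsP[A]].
rewrite Nv subset1 => /andP[PA /orP[/eqP<- //|/eqP A0]].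
by rewrite -A0 PA in P0.
Qed.

Section CoronaEdgeless.
Variables G H : sgraph.
Hypothesis edgeless : forall h k : H, adj h k = false.

Definition base_singletons : {set {set corona G H}} :=
  [set [set inl x] | x : G].

Definition pendants : {set corona G H} := [set inr p | p : G * H].

Lemma card_base_singletons : #|base_singletons| = #|G|.
Proof. by apply: card_imset => x y /set1_inj[]. Qed.

Lemma base_singletons_notin (A : {set corona G H}) p :
  inr p \in A -> A \notin base_singletons.
Proof. by move=> Ap; apply/imsetP=> -[x _ def_A]; rewrite def_A inE in Ap. Qed.

Lemma neighbors_pendant x h :
  neighbors (inr (x, h) : corona G H) = [set inl x].
Proof.
apply/setP=> -[y|[y k]]; rewrite !inE /=; first by rewrite eq_sym.
by rewrite edgeless andbF.
Qed.

Lemma td_coloring_corona_lb P (x : G) (h : H) :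
  @td_coloring (corona G H) P -> #|G| < #|P|.
Proof.
move=> tdP; have /andP[/andP[/and3P[/eqP covP _ _] _] _] := tdP.
have: (inr (x, h) : corona G H) \in cover P by rewrite covP inE.
case/bigcupP=> A PA Ah.
have <- : #|A |: base_singletons| = #|G|.+1.
  by rewrite cardsU1 (base_singletons_notin _ _ Ah) card_base_singletons.
apply/subset_leq_card/subsetP=> B /setU1P[-> //|/imsetP[y _ ->]].
exact: td_coloring_pendant (neighbors_pendant y h) tdP.
Qed.

Lemma td_coloring_corona_ub (x : G) (h : H) :
  no_isolated_vertex G -> td_coloring (pendants |: base_singletons).
Proof.
move=> /forallP isoG.
have basep y : [set inl y] \in pendants |: base_singletons.
  by apply/setU1r/imset_f.
have pend_base y : [disjoint pendants & [set inl y]].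
  by rewrite disjoint_sym disjoints1; apply/imsetP=> -[].
apply/andP; split; last first.
  apply/forallP=> -[y|[y k]]; apply/existsP.
    have /existsP[z yz] := isoG y.
    by exists [set inl z]; rewrite basep sub1set inE.
  by exists [set inl y]; rewrite basep neighbors_pendant subxx.
apply/andP; split; [apply/and3P; split|].
- apply/eqP/setP=> v; rewrite inE; apply/bigcupP; case: v => [y|p].
    by exists [set inl y]; rewrite ?basep // set11.
  by exists pendants; rewrite ?setU11 ?imset_f.
- apply/trivIsetP=> A B /setU1P[->|/imsetP[y _ ->]] /setU1P[->|/imsetP[z _ ->]].
  + by rewrite eqxx.
  + by rewrite pend_base.
  + by rewrite disjoint_sym pend_base.
  + by rewrite disjoints1 inE; apply: contraNneq => ->.
- (* The class of pendant vertices is nonempty because both factors are. *)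
  apply/setU1P=> -[/setP/(_ (inr (x, h)))|/imsetP[y _ /setP/(_ (inl y))]].
    by rewrite inE imset_f.
  by rewrite !inE eqxx.
apply/forall_inP=> A /setU1P[->|/imsetP[y _ ->]].
  apply/forall_inP=> _ /imsetP[[y k] _ ->].
  apply/forall_inP=> _ /imsetP[[z l] _ ->] /=.
  by rewrite edgeless andbF.
apply/forall_inP=> _ /set1P->; apply/forall_inP=> _ /set1P->.
by rewrite adj_irrefl.
Qed.

(** The base graph must be nonempty: otherwise the corona is empty and has the
    TD-coloring without classes. *)
Lemma td_chromatic_number_corona_edgeless :
  0 < #|G| -> 0 < #|H| -> no_isolated_vertex G ->
  td_chromatic_number (corona G H) = #|G|.+1.
Proof.
move=> /card_gt0P[x _] H_gt0 isoG; have /card_gt0P[h _] := H_gt0.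
have [[P tdP defP] minP] := td_chromatic_numberP (corona_no_isolated G H_gt0).
apply/eqP; rewrite eqn_leq -{2}defP (td_coloring_corona_lb _ x h) // andbT.
have <- : #|pendants |: base_singletons| = #|G|.+1.
  rewrite cardsU1 card_base_singletons.
  by rewrite (base_singletons_notin _ (x, h)) ?imset_f.
exact/minP/td_coloring_corona_ub.
Qed.

End CoronaEdgeless.

Lemma path_no_isolated n : 1 < n -> no_isolated_vertex (path_graph n).
Proof.
move=> n_gt1; apply/forallP=> i; apply/existsP.
have [i1_lt_n|n_le_i1] := ltnP i.+1 n.
  by exists (Ordinal i1_lt_n); rewrite /= /path_adj eqxx.
(* Otherwise [i] is the last vertex, and [i.-1] is a neighbor as [1 < n]. *)
have i_gt0 : 0 < i by rewrite -ltnS (leq_trans n_gt1).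
have i1_lt_n : i.-1 < n by rewrite (leq_ltn_trans (leq_pred i)).
by exists (Ordinal i1_lt_n); rewrite /= /path_adj /= prednK // eqxx orbT.
Qed.

Theorem theorem3 (n m : nat) (hn : 2 <= n) (hm : 1 <= m) :
  td_chromatic_number (corona (path_graph n) (complement (complete_graph m))) = n.+1.
Proof.
rewrite td_chromatic_number_corona_edgeless ?card_ord ?path_no_isolated //.
  by move=> h k; rewrite /= /complement_adj /= /complete_adj andbN.
exact: ltnW.
Qed.
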